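(* Let $n\ge1$ and $\mathfrak g=\mathfrak{gl}(m\cdot\mathbf 1+nP)$. Let $S=\{x_1,\dots,x_m,y_1,\dots,y_n,y_1',\dots,y_n'\}$ be a basis of $m\cdot\mathbf 1+nP$ with $dx_i=0$, $dy_i=y_i'$, and let $z^*$ ($z\in S$) be the dual basis. Adjoint-invariant bilinear forms on $\mathfrak g$ are classified by two parameters, $\lambda$ and $\mu$, as follows. When $m$ is odd, a bilinear form $B=B_{\lambda,\mu}$ on $\mathfrak g$ is defined by: $B(x,y)=\mu\operatorname{Tr}(xy)$ for $x,y\in\mathfrak{sl}(m\cdot\mathbf 1+nP)$; $B(I,I)=\lambda$; $B(I,x)=0$ for $x\in\mathfrak{sl}(m\cdot\mathbf 1+nP)$; where $I=\sum_{z\in S}z\otimes z^*$ is the identity matrix. When $m$ is even, a bilinear form $B=B_{\lambda,\mu}$ on $\mathfrak g$ is defined by: $B(x,y)=\mu\operatorname{Tr}(xy)$ for $x,y\in\mathfrak{sl}(m\cdot\mathbf 1+nP)$; $B(h_{y_n},h_{y_n})=\lambda$; $B(h_{y_n},I)=\mu$; $B(h_{y_n},x)=0$ for $x=z\otimes w^*$ with $z\ne w$, or $x=z\otimes z^*+y_n'\otimes{y_n'}^*$; where $h_{y_n}:=y_n\otimes y_n^*$. In both cases $B$ is symmetric. It is nondegenerate when - $\mu\ne0$, if $m$ is even; - $\lambda\ne0$, if $m$ is odd. The Casimir element associated to $B_{\lambda,\mu}$ is $$\frac{\lambda}{\mu^2}\sum_{i=1}^m\big((x_i\otimes x_i^*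 )^2+x_i\otimes x_i^*\big)+\frac{\lambda+\mu}{\mu^2}\sum_{z\in S}z\otimes z^*$$ when $m$ is even, and $$\frac1\lambda\sum_{i=1}^m\big((x_i\otimes x_i^* )^2+x_i\otimes x_i^*\big)+\frac1\lambda\sum_{z\in S}z\otimes z^*$$ when $m$ is odd.
   Context: Let $k$ be an algebraically closed field of characteristic $2$. $\mathrm{Ver}_4^+$ is the symmetric tensor category whose objects are finite-dimensional $k$-vector spaces $V$ with a linear endomorphism $d$, $d^2=0$ (write $x'=dx$), morphisms are linear maps commuting with $d$, with $d$ acting on tensor products by $d\otimes1+1\otimes d$ and braiding $c(v\otimes w)=w\otimes v+w'\otimes v'$. $\mathbf 1$ is the one-dimensional object with $d=0$; $P$ is the two-dimensional object $k[d]/d^2$. For an object $X$, $\mathfrak{gl}(X)=X\otimes X^*$ is the space of all linear endomorphisms of $X$ ($z\otimes w^*$ being $u\mapsto w^*(u)z$), with $A'=dA+Ad$ and bracket $[A,B]=AB-BA-B'A'$ (the braided commutator). $\mathfrak{sl}(X)\subset\mathfrak{gl}(X)$ is the kernel of the evaluation (trace) map $\operatorname{Tr}:\mathfrak{gl}(X)\to\mathbf 1$. $U(\mathfrak g)$ is the quotient of the tensor algebra $T\mathfrak g$ by the relations $a\otimes b-b\otimes a-b'\otimes a'=[a,b]$. A bilinear form on $\mathfrak g$ is a morphism $B:\mathfrak g\otimes\mathfrak g\to\mathbf 1$ in $\mathrm{Ver}_4^+$. It is adjoint-invariant if $B(\mathrm{ad}_XY,Z)+B(Y,\mathrm{ad}_XZ)=0$,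 understood in $\mathrm{Ver}_4^+$, i.e. the induced map $\mathfrak g\to\mathfrak g^*$ is a map of $\mathfrak g$-modules; on elements, including the braiding term, $B([X,Y],Z)+B(Y,[X,Z])+B(Y',[X',Z])=0$ for all $X,Y,Z$. Symmetric means $B(X,Y)=B(Y,X)$. For a nondegenerate adjoint-invariant $B$, the Casimir element for $B$ is the image of $1$ under $\mathbf 1\xrightarrow{\mathrm{coev}}\mathfrak g\otimes\mathfrak g^*\cong\mathfrak g\otimes\mathfrak g\to U(\mathfrak g)$, where $\mathfrak g^*\cong\mathfrak g$ is induced by $B$ and the last map is multiplication.
   Formalization: For m odd, nondegeneracy is stated for λ≠0 and μ≠0 (at μ=0 the form vanishes on sl, so it is degenerate); for m even, the condition B(h_{y_n}, z⊗z*+y_n'⊗y_n'* )=0 is imposed only for z≠y_n, since with z=y_n it contradicts B(h_{y_n},I)=μ when μ≠0. *)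

(* Defs.v *)
From HB Require Import structures.
From mathcomp Require Import all_boot all_order all_algebra sesquilinear.
From mathcomp Require Import boolp.
From mathcomp Require Import monalg.

Set Implicit Arguments.
Unset Strict Implicit.
Unset Printing Implicit Defensive.

Import GRing.Theory.

Local Open Scope ring_scope.

(* An object of Ver_4^+ (when k has characteristic 2): a finite-dimensional
   space with a square-zero endomorphism. *)
Record ver4p (k : fieldType) := Ver4p {
  carrier :> vectType k;
  dif : 'End(carrier);
  dif_sq : (dif \o dif)%VF = 0
}.

Section Gl.
Context (k : fieldType) (X : ver4p k).
Implicit Types A B : 'End(X).

(* z (x) f, for f in the dual of X, as the endomorphism u |-> f(u) z *)
Definition outer (z : X) (f : 'Hom(X, k^o)) : 'End(X) :=
  linfun (fun u => (f u : k) *: z).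

Definition gl_dif A : 'End(X) := (dif X \o A)%VF + (A \o dif X)%VF.

Lemma gl_dif_sq A : 2%N \in [pchar k] -> gl_dif (gl_dif A) = 0.
Proof.
move=> k2; rewrite /gl_dif comp_lfunDr comp_lfunDl !comp_lfunA dif_sq comp_lfun0l.
rewrite add0r -(comp_lfunA A) dif_sq comp_lfun0r addr0 -mulr2n -scaler_nat.
by rewrite (pcharf0 k2) scale0r.
Qed.

Definition gl_br A B : 'End(X) :=
  (A \o B)%VF - (B \o A)%VF - (gl_dif B \o gl_dif A)%VF.

(* The braiding sends z (x) f to f (x) z + f' (x) z', and f'(z') = f(z'') = 0,
   so evaluation on X (x) X^* is the ordinary trace. *)
Definition gl_tr A : k :=
  \sum_(i < \dim {:X}) coord (vbasis {:X}) i (A (vbasis {:X})`_i).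

Definition in_sl A : Prop := gl_tr A = 0.

End Gl.

(* The quotient of an algebra by the two-sided ideal generated by [rel]. It is
   registered as a ring and as a k-module; [algType] would require 1 != 0, so the
   compatibility of the two structures is given by the lemmas [quot_scaleAl] and
   [quot_scaleAr]. *)
Section AlgebraQuotient.
Context (k : fieldType) (T : algType k) (rel : T -> Prop).

Inductive ideal_gen : T -> Prop :=
| ideal_gen_rel t : rel t -> ideal_gen t
| ideal_gen0 : ideal_gen 0
| ideal_genD s t : ideal_gen s -> ideal_gen t -> ideal_gen (s + t)
| ideal_genMl s t : ideal_gen t -> ideal_gen (s * t)
| ideal_genMr s t : ideal_gen t -> ideal_gen (t * s).

Definition ideal_genb : pred T := fun t => `[< ideal_gen t >].

Lemma ideal_genP t : reflect (ideal_gen t) (t \in ideal_genb).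
Proof. exact: asboolP. Qed.

Lemma ideal_gen_closed : zmod_closed ideal_genb.
Proof.
split=> [|s t /ideal_genP Is /ideal_genP It]; apply/ideal_genP.
  exact: ideal_gen0.
by apply: ideal_genD => //; rewrite -mulN1r; apply: ideal_genMl.
Qed.

HB.instance Definition _ :=
  GRing.isZmodClosed.Build T ideal_genb ideal_gen_closed.

Definition algquot : Type :=
  Quotient.quot (GRing.ZmodClosed.clone T ideal_genb _).

HB.instance Definition _ := Choice.on algquot.
HB.instance Definition _ := EqQuotient.on algquot.

End AlgebraQuotient.

(* The operations are locked so that unification does not unfold them. *)
HB.lock Definition quot_pi (k : fieldType) (T : algType k) (rel : T -> Prop)
  (t : T) : algquot rel := (\pi_(algquot rel) t)%qT.
HB.lock Definition quot_opp (k : fieldType) (T : algType k) (rel : T -> Prop)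
  (u : algquot rel) : algquot rel := quot_pi rel (- repr u).
HB.lock Definition quot_add (k : fieldType) (T : algType k) (rel : T -> Prop)
  (u v : algquot rel) : algquot rel := quot_pi rel (repr u + repr v).
HB.lock Definition quot_mul (k : fieldType) (T : algType k) (rel : T -> Prop)
  (u v : algquot rel) : algquot rel := quot_pi rel (repr u * repr v).
HB.lock Definition quot_scale (k : fieldType) (T : algType k) (rel : T -> Prop)
  (c : k) (u : algquot rel) : algquot rel := quot_pi rel (c *: repr u).

Section AlgebraQuotientTheory.
Context (k : fieldType) (T : algType k) (rel : T -> Prop).

Local Notation algquot := (algquot rel).
Local Notation quot_pi := (quot_pi rel).
Local Notation ideal_gen := (ideal_gen rel).

Lemma quot_piP s t : quot_pi s = quot_pi t <-> ideal_gen (s - t).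
Proof.
rewrite quot_pi.unlock; split=> [e|/ideal_genP].
  by apply/ideal_genP; rewrite Quotient.idealrBE; apply/eqP.
by rewrite Quotient.idealrBE => /eqP.
Qed.

Lemma quot_reprK : cancel (repr : algquot -> T) quot_pi.
Proof. by move=> u; rewrite quot_pi.unlock reprK. Qed.

Lemma ideal_gen_repr s : ideal_gen (s - repr (quot_pi s)).
Proof. by apply/quot_piP; rewrite quot_reprK. Qed.

Lemma quot_piN_def s : quot_pi (- s) = quot_opp (quot_pi s).
Proof.
rewrite quot_opp.unlock; apply/quot_piP.
by rewrite -opprD -mulN1r; apply/ideal_genMl/ideal_gen_repr.
Qed.

Lemma quot_piD_def s t : quot_pi (s + t) = quot_add (quot_pi s) (quot_pi t).
Proof.
rewrite quot_add.unlock; apply/quot_piP.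
by rewrite opprD addrACA; apply: ideal_genD; apply: ideal_gen_repr.
Qed.

Lemma quot_piM_def s t : quot_pi (s * t) = quot_mul (quot_pi s) (quot_pi t).
Proof.
rewrite quot_mul.unlock; apply/quot_piP.
rewrite -(subrKA (repr (quot_pi s) * t)) -mulrBl -mulrBr.
by apply: ideal_genD; [apply: ideal_genMr | apply: ideal_genMl];
  apply: ideal_gen_repr.
Qed.

Lemma quot_piZ_def c s : quot_pi (c *: s) = quot_scale c (quot_pi s).
Proof.
rewrite quot_scale.unlock; apply/quot_piP; rewrite -scalerBr -mulr_algl.
by apply: ideal_genMl; apply: ideal_gen_repr.
Qed.

Fact quot_addA : associative (@quot_add k T rel).
Proof.
move=> u v w; rewrite -[u]quot_reprK -[v]quot_reprK -[w]quot_reprK.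
by rewrite -!quot_piD_def addrA.
Qed.

Fact quot_addC : commutative (@quot_add k T rel).
Proof.
by move=> u v; rewrite -[u]quot_reprK -[v]quot_reprK -!quot_piD_def addrC.
Qed.

Fact quot_add0 : left_id (quot_pi 0) (@quot_add k T rel).
Proof. by move=> u; rewrite -[u]quot_reprK -quot_piD_def add0r. Qed.

Fact quot_addN : left_inverse (quot_pi 0) (@quot_opp k T rel) (@quot_add k T rel).
Proof.
by move=> u; rewrite -[u]quot_reprK -quot_piN_def -quot_piD_def addNr.
Qed.

HB.instance Definition _ := GRing.isZmodule.Build algquot
  quot_addA quot_addC quot_add0 quot_addN.

Lemma quot_piD s t : quot_pi (s + t) = quot_pi s + quot_pi t.
Proof. exact: quot_piD_def. Qed.

Fact quot_mulA : associative (@quot_mul k T rel).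
Proof.
move=> u v w; rewrite -[u]quot_reprK -[v]quot_reprK -[w]quot_reprK.
by rewrite -!quot_piM_def mulrA.
Qed.

Fact quot_mul1 : left_id (quot_pi 1) (@quot_mul k T rel).
Proof. by move=> u; rewrite -[u]quot_reprK -quot_piM_def mul1r. Qed.

Fact quot_mulr1 : right_id (quot_pi 1) (@quot_mul k T rel).
Proof. by move=> u; rewrite -[u]quot_reprK -quot_piM_def mulr1. Qed.

Fact quot_mulDl : left_distributive (@quot_mul k T rel) +%R.
Proof.
move=> u v w; rewrite -[u]quot_reprK -[v]quot_reprK -[w]quot_reprK.
by rewrite -quot_piD -!quot_piM_def mulrDl quot_piD.
Qed.

Fact quot_mulDr : right_distributive (@quot_mul k T rel) +%R.
Proof.
move=> u v w; rewrite -[u]quot_reprK -[v]quot_reprK -[w]quot_reprK.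
by rewrite -quot_piD -!quot_piM_def mulrDr quot_piD.
Qed.

HB.instance Definition _ := GRing.Zmodule_isPzRing.Build algquot
  quot_mulA quot_mul1 quot_mulr1 quot_mulDl quot_mulDr.

Fact quot_scaleA a b (v : algquot) : quot_scale a (quot_scale b v) = quot_scale (a * b) v.
Proof. by rewrite -[v]quot_reprK -!quot_piZ_def scalerA. Qed.

Fact quot_scale1 : left_id 1 (@quot_scale k T rel).
Proof. by move=> u; rewrite -[u]quot_reprK -quot_piZ_def scale1r. Qed.

Fact quot_scaleDr : right_distributive (@quot_scale k T rel) +%R.
Proof.
move=> c u v; rewrite -[u]quot_reprK -[v]quot_reprK.
by rewrite -quot_piD -!quot_piZ_def scalerDr quot_piD.
Qed.

Fact quot_scaleDl (v : algquot) : {morph (@quot_scale k T rel)^~ v : a b / a + b}.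
Proof.
by move=> a b; rewrite -[v]quot_reprK -!quot_piZ_def scalerDl quot_piD.
Qed.

HB.instance Definition _ := GRing.Zmodule_isLmodule.Build k algquot
  quot_scaleA quot_scale1 quot_scaleDr quot_scaleDl.

Lemma quot_piM s t : quot_pi (s * t) = quot_pi s * quot_pi t.
Proof. exact: quot_piM_def. Qed.

Lemma quot_piZ c s : quot_pi (c *: s) = c *: quot_pi s.
Proof. exact: quot_piZ_def. Qed.

Lemma quot_scaleAl a (u v : algquot) : a *: (u * v) = (a *: u) * v.
Proof.
rewrite -[u]quot_reprK -[v]quot_reprK.
by rewrite -quot_piZ -!quot_piM -quot_piZ scalerAl.
Qed.

Lemma quot_scaleAr a (u v : algquot) : a *: (u * v) = u * (a *: v).
Proof.
rewrite -[u]quot_reprK -[v]quot_reprK.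
by rewrite -quot_piZ -!quot_piM -quot_piZ scalerAr.
Qed.

Lemma quot_comm_rel a b c d e : rel (a * b - b * a - c * d - e) ->
  quot_pi a * quot_pi b - quot_pi b * quot_pi a - quot_pi c * quot_pi d
  = quot_pi e.
Proof.
have piB s t : quot_pi (s - t) = quot_pi s - quot_pi t.
  by rewrite -[- t]scaleN1r quot_piD quot_piZ scaleN1r.
by move=> Ht; rewrite -!quot_piM -!piB; apply/quot_piP/ideal_gen_rel.
Qed.

Fact quot_pi_linear : linear quot_pi.
Proof. by move=> c s t; rewrite quot_piD quot_piZ. Qed.

Fact quot_pi_monoid : monoid_morphism quot_pi.
Proof. by split=> // s t; apply: quot_piM. Qed.

HB.instance Definition _ :=
  GRing.isLinear.Build k T algquot _ quot_pi quot_pi_linear.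
HB.instance Definition _ :=
  GRing.isMonoidMorphism.Build T algquot quot_pi quot_pi_monoid.

End AlgebraQuotientTheory.

Fact malg_scaleAr (K : monomType) (R : comNzRingType) (c : R)
  (s t : {malg R[K]}) : c *: (s * t) = s * (c *: t).
Proof.
have malgC_comm : c%:MP * s = s * c%:MP.
  rewrite !malgM_def fgmulUg fgmulgU; apply: eq_bigr => w _.
  by rewrite mulrC mul1m mulm1.
by rewrite -[LHS]mul_malgC -[in RHS]mul_malgC !mulrA malgC_comm.
Qed.

Section Envelope.
Context (k : fieldType) (g : vectType k) (dg : g -> g) (br : g -> g -> g).

(* The tensor algebra of g, as the free algebra on the basis [vbasis {:g}]. *)
Definition tensalg : Type := {malg k[{fmonom 'I_(\dim {:g})}]}.

HB.instance Definition _ := GRing.Lalgebra.on tensalg.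
HB.instance Definition _ := GRing.Lalgebra_isAlgebra.Build k tensalg
  (@malg_scaleAr {fmonom 'I_(\dim {:g})} k).

Definition tens_in (a : g) : tensalg :=
  \sum_(i < \dim {:g}) coord (vbasis {:g}) i a *: << fmu i >>.

Lemma tens_in_linear : linear tens_in.
Proof.
move=> c a b; rewrite /tens_in scaler_sumr -big_split /=.
by apply: eq_bigr => i _; rewrite linearP scalerDl scalerA.
Qed.

HB.instance Definition _ :=
  GRing.isLinear.Build k g tensalg _ tens_in tens_in_linear.

Inductive env_rel : tensalg -> Prop :=
| EnvRel a b :
    env_rel (tens_in a * tens_in b - tens_in b * tens_in a
             - tens_in (dg b) * tens_in (dg a) - tens_in (br a b)).

Definition envalg : Type := algquot env_rel.

HB.instance Definition _ := GRing.PzRing.on envalg.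
HB.instance Definition _ := GRing.Lmodule.on envalg.

Definition env_in (a : g) : envalg := quot_pi env_rel (tens_in a).

Lemma env_in_linear : linear env_in.
Proof.
by move=> c a b; rewrite /env_in (tens_in_linear c a b) quot_pi_linear.
Qed.

HB.instance Definition _ :=
  GRing.isLinear.Build k g envalg _ env_in env_in_linear.

Lemma env_in_rel a b :
  env_in a * env_in b - env_in b * env_in a - env_in (dg b) * env_in (dg a)
  = env_in (br a b).
Proof. exact/quot_comm_rel/EnvRel. Qed.

End Envelope.

Section Forms.
Context (k : fieldType) (g : vectType k) (dg : g -> g) (br : g -> g -> g).
Implicit Type B : {biscalar g}.

(* B commutes with the differentials d (x) 1 + 1 (x) d of g (x) g and 0 of the
   unit object. *)
Definition form_mor B : Prop := forall a b, B (dg a) b + B a (dg b) = 0.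

Definition adj_invariant B : Prop := forall a b c,
  B (br a b) c + B b (br a c) + B (dg b) (br (dg a) c) = 0.

Definition invariant_form B : Prop := form_mor B /\ adj_invariant B.

Definition form_symmetric B : Prop := forall a b, B a b = B b a.

Definition form_map B : 'Hom(g, 'Hom(g, k^o)) :=
  linfun (fun a => linfun (B a : g -> k^o)).

Definition form_nondegenerate B : Prop := bijective (form_map B).

Definition casimir B : envalg dg br :=
  \sum_(i < \dim {:g})
     env_in dg br (vbasis {:g})`_i *
     env_in dg br
       ((form_map B)^-1%VF (linfun (coord (vbasis {:g}) i : g -> k^o))).

(* The forms [P lam mu] are well defined, and they are all the adjoint-invariant
   forms, each arising from exactly one pair of parameters. *)
Definition classified (P : k -> k -> {biscalar g} -> Prop) : Prop :=
  (forall lam mu : k, exists B, [/\ invariant_form B, P lam mu B &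
     forall B', invariant_form B' -> P lam mu B' -> B' =2 B])
  /\ (forall B, invariant_form B -> exists! p : k * k, P p.1 p.2 B).

End Forms.

Section GlStructure.
Context (k : fieldType) (X : ver4p k).

Definition gl_env : Type := envalg (@gl_dif k X) (@gl_br k X).

HB.instance Definition _ := GRing.PzRing.on gl_env.
HB.instance Definition _ := GRing.Lmodule.on gl_env.

Definition gl_in (a : 'End(X)) : gl_env := env_in (@gl_dif k X) (@gl_br k X) a.

Lemma gl_in_linear : linear gl_in.
Proof. exact: env_in_linear. Qed.

HB.instance Definition _ :=
  GRing.isLinear.Build k 'End(X) gl_env _ gl_in gl_in_linear.

Lemma gl_in_rel a b :
  gl_in a * gl_in b - gl_in b * gl_in a - gl_in (gl_dif b) * gl_in (gl_dif a)
  = gl_in (gl_br a b).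
Proof. exact: env_in_rel. Qed.

Definition gl_invariant (B : {biscalar 'End(X)}) : Prop :=
  invariant_form (@gl_dif k X) (@gl_br k X) B.

Definition gl_casimir (B : {biscalar 'End(X)}) : gl_env :=
  casimir (@gl_dif k X) (@gl_br k X) B.

End GlStructure.

Section AdaptedBasis.
Context (k : fieldType) (m n : nat) (X : ver4p k).
Context (x : m.-tuple X) (y : n.-tuple X).

(* x_1, ..., x_m, y_1, ..., y_n, y_1', ..., y_n' *)
Definition adapted : (m + (n + n)).-tuple X :=
  cat_tuple x (cat_tuple y (map_tuple (dif X) y)).

(* X is m.1 + nP, with this basis *)
Definition adapted_basis : Prop :=
  (forall i, dif X (tnth x i) = 0) /\ basis_of {:X} adapted.

Definition ix (i : 'I_m) : 'I_(m + (n + n)) := lshift _ i.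
Definition iy (j : 'I_n) : 'I_(m + (n + n)) := rshift m (lshift n j).
Definition iy' (j : 'I_n) : 'I_(m + (n + n)) := rshift m (rshift n j).

Definition dual (w : 'I_(m + (n + n))) : 'Hom(X, k^o) :=
  linfun (coord adapted w : X -> k^o).

Definition unit_op (z w : 'I_(m + (n + n))) : 'End(X) :=
  outer (tnth adapted z) (dual w).

Definition form_on_sl (mu : k) (B : {biscalar 'End(X)}) : Prop :=
  forall a b, in_sl a -> in_sl b -> B a b = mu * gl_tr (a \o b)%VF.

Definition form_odd (lam mu : k) (B : {biscalar 'End(X)}) : Prop :=
  [/\ form_on_sl mu B, B \1%VF \1%VF = lam &
      forall a, in_sl a -> B \1%VF a = 0].

(* In the last clause z = y_n has to be left out: the identity is the sum of the
   elements z (x) z^* + y_n' (x) y_n'^* over z <> y_n', so including z = y_n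
   would contradict B(h, 1) = mu unless mu = 0. *)
Definition form_even (jn : 'I_n) (lam mu : k) (B : {biscalar 'End(X)}) : Prop :=
  let h := unit_op (iy jn) (iy jn) in
  [/\ form_on_sl mu B, B h h = lam, B h \1%VF = mu,
      forall z w, z != w -> B h (unit_op z w) = 0 &
      forall z, z != iy jn ->
        B h (unit_op z z + unit_op (iy' jn) (iy' jn)) = 0].

Definition casimir_quad : gl_env X :=
  \sum_(i < m) (gl_in (unit_op (ix i) (ix i)) ^+ 2
                + gl_in (unit_op (ix i) (ix i))).

Definition casimir_lin : gl_env X :=
  \sum_(z < m + (n + n)) gl_in (unit_op z z).

End AdaptedBasis.

Definition last_ord (n : nat) (n_gt0 : (0 < n)%N) : 'I_n :=
  Ordinal (etrans (ltn_predL n) n_gt0).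

(* Main.v *)
Require Import Defs.
From HB Require Import structures.
From mathcomp Require Import all_boot all_order all_algebra sesquilinear.
From mathcomp Require Import ring.

Set Implicit Arguments.
Unset Strict Implicit.
Unset Printing Implicit Defensive.

Import GRing.Theory.

Local Open Scope ring_scope.

(** Every invariant form on gl(X) is a combination
      mu Tr(ab) + nu Tr(a) Tr(b),
    and both normalisations of the theorem mean nu = lam + mu. The theorem is
    then linear algebra with these two trace forms, plus one computation in the
    enveloping algebra.

    Classification. Let h be the matrix unit at (y_n, y_n). The operators on
    which two invariant forms agree (against every second argument) form a
    subspace stable under the differential and under all brackets, and the
    smallest such subspace containing h is everything ([idempotent_generates]).
    So it is enough to compute B(h, -). Moving derivatives from one
    argument to the other, invariance takes the form
      B([a,b], c) = B(b, ac + ca + a'c')          ([form_br]).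
    Taking for a an operator that brackets h to 0, this says that B(h, -)
    vanishes on ac + ca + a'c': with a a diagonal matrix unit, B(h, -) vanishes
    off the diagonal, and with a an off-diagonal one and c its transpose, it is
    constant on the diagonal outside h. Hence B(h, -) has two degrees of freedom,
    those of the two trace forms ([invariant_trace_form]).

    Nondegeneracy. The identity pairs with a to (mu + m nu) Tr(a), because
    Tr(1) = m + 2n = m; on trace-zero operators the form is mu times the trace
    pairing. So the form is nondegenerate exactly if mu and mu + m nu are
    nonzero, and mu + m nu is mu for even m and lam for odd m.

    Casimir element. For t = nu / (mu (mu + m nu)) the family dual to the matrix
    units E_zw is E_wz / mu, corrected by t times the identity when z = w. Hence
    the Casimir element is
      mu^-1 sum_(z,w) E_zw E_wz + t I I.
    In the enveloping algebra the relation for a pair (a, a) says that a' a'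
    equals the linear element given by the operator a'^2 ([rep_dif_sq]). The
    identity of each copy of P is such a derivative, so its square is linear; this
    is why only the squares at the x_i survive in both I I and the diagonal part
    of the first sum. Off the diagonal E_zw and E_wz anticommute to
    E_zz + E_ww plus a product of derivatives, and the latter products cancel in
    pairs between the y-block and the y'-block ([rep_dif_pairs]). *)

(** * Characteristic two *)

Section CharTwo.
Context (k : fieldType) (k2 : 2%N \in [pchar k]) (V : lmodType k).
Implicit Types u v w : V.

Lemma addvv2 v : v + v = 0.
Proof. by rewrite -mulr2n -scaler_nat (pcharf0 k2) scale0r. Qed.

Lemma oppv2 v : - v = v.
Proof. by apply/eqP; rewrite -subr_eq0 -opprD addvv2 oppr0. Qed.

Lemma addvK2 u v : u + v + v = u.
Proof. by rewrite -addrA addvv2 addr0. Qed.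

Lemma addv_eq0 u v : u + v = 0 -> u = v.
Proof. by move/eqP; rewrite addr_eq0 oppv2 => /eqP. Qed.

Lemma natr_parity r : r%:R = (odd r)%:R :> k.
Proof.
rewrite -[in LHS](odd_double_half r) natrD -mul2n natrM (pcharf0 k2) mul0r.
exact: addr0.
Qed.

End CharTwo.

(** * Rank-one operators *)

Section RankOne.
Context (k : fieldType) (X : ver4p k).
Implicit Types (u v : X) (f g : 'Hom(X, k^o)) (A B : 'End(X)).

Local Notation d := (dif X).

(** The function behind [outer] is linear, but [linfun] makes sense for every
    function; this recovers its values. *)
Lemma outerE u f v : outer u f v = (f v : k) *: u.
Proof.
have lin : linear (fun w : X => (f w : k) *: u).
  by move=> c a b; rewrite linearP scalerDl scalerA.
pose F := GRing.isLinear.Build k X X _ (fun w : X => (f w : k) *: u) lin.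
pose F' : {linear X -> X} := HB.pack (fun w : X => (f w : k) *: u) F.
exact: (lfunE F').
Qed.

Lemma outer_is_bilinear :
  bilinear_for (GRing.Scale.Law.clone _ _ *:%R _)
    (GRing.Scale.Law.clone _ _ *:%R _)
    (@outer k X : X -> 'Hom(X, k^o) -> 'End(X)).
Proof.
split=> [f|u] c a b; apply/lfunP=> w; rewrite !lfunE /= !lfunE /= !outerE.
  by rewrite scalerDr !scalerA mulrC.
by rewrite !lfunE /= !lfunE scalerDl scalerA.
Qed.

HB.instance Definition _ := bilinear_isBilinear.Build k X 'Hom(X, k^o) 'End(X)
  _ _ (@outer k X) outer_is_bilinear.

Lemma outer0l f : outer 0 f = 0 :> 'End(X).
Proof. exact: linear0l. Qed.

Lemma outer0r u : outer u 0 = 0.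
Proof. exact: linear0r. Qed.

Lemma comp_lfun_outer A u f : (A \o outer u f)%VF = outer (A u) f.
Proof. by apply/lfunP=> w; rewrite lfunE /= !outerE linearZ. Qed.

Lemma outer_comp_lfun u f A : (outer u f \o A)%VF = outer u (f \o A)%VF.
Proof. by apply/lfunP=> w; rewrite lfunE /= !outerE lfunE. Qed.

Lemma outerM u f v g : (outer u f \o outer v g)%VF = (f v : k) *: outer u g.
Proof. by rewrite comp_lfun_outer outerE; exact: linearZl_LR. Qed.

Lemma gl_dif_outer u f :
  gl_dif (outer u f) = outer (d u) f + outer u (f \o d)%VF.
Proof. by rewrite /gl_dif comp_lfun_outer outer_comp_lfun. Qed.

Lemma comp_dif_dif f : (f \o d \o d)%VF = 0.
Proof. by rewrite -comp_lfunA dif_sq comp_lfun0r. Qed.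

Lemma dif_dif u : d (d u) = 0.
Proof. by rewrite -comp_lfunE dif_sq lfunE. Qed.

(** Every operator is the sum of the rank-one operators that it induces on a
    basis; this reduces linear statements about operators to rank one. *)
Lemma outer_sum r (b : r.-tuple X) (bX : basis_of {:X} b) A :
  A = \sum_(i < r) outer (A (tnth b i)) (linfun (coord b i : X -> k^o)).
Proof.
apply/lfunP=> u; rewrite sum_lfunE [in LHS](coord_basis bX (memvf u)) linear_sum.
by apply: eq_bigr => i _; rewrite linearZ outerE lfunE -tnth_nth.
Qed.

End RankOne.

(** * Nondegenerate forms and dual families *)

Section FormMap.
Context (k : fieldType) (g : vectType k) (dg : g -> g) (br : g -> g -> g).
Context (B : {biscalar g}).

Lemma form_mapE a b : form_map B a b = B a b.
Proof.
have inner u v : linfun (B u : g -> k^o) v = B u v.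
  have lin : linear (B u : g -> k^o) by move=> s v1 v2; apply: linearPr.
  pose F := GRing.isLinear.Build k g k^o _ (B u : g -> k^o) lin.
  pose F' : {linear g -> k^o} := HB.pack (B u : g -> k^o) F.
  exact: (lfunE F').
pose G u := linfun (B u : g -> k^o).
have lin : linear G.
  move=> s u1 u2; apply/lfunP=> v.
  by rewrite !inner linearPl lfunE /= lfunE /= !inner.
pose F := GRing.isLinear.Build k g 'Hom(g, k^o) _ G lin.
pose F' : {linear g -> 'Hom(g, k^o)} := HB.pack G F.
by rewrite /form_map (lfunE F') inner.
Qed.

Lemma form_nondegenerateP :
  form_nondegenerate B <-> (forall a, (forall b, B a b = 0) -> a = 0).
Proof.
split=> [/bij_inj inj a a0|B0].
  by apply: inj; apply/lfunP=> b; rewrite form_mapE a0 linear0 lfunE.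
have ker0 : lker (form_map B) == 0%VS.
  rewrite -subv0; apply/subvP=> a; rewrite memv_ker memv0 => /eqP a0.
  by apply/eqP/B0=> b; rewrite -form_mapE a0 lfunE.
exists (form_map B)^-1%VF; first exact: lker0_lfunK.
move=> f; apply: limg_lfunVK; suff -> : limg (form_map B) = fullv by apply: memvf.
apply/eqP; rewrite eqEdim subvf limg_dim_eq; last by rewrite (eqP ker0) capv0.
by rewrite !dimvf; apply: eq_leq (muln1 _).
Qed.

Lemma form_mapK : form_nondegenerate B -> cancel (form_map B) (form_map B)^-1%VF.
Proof. by move=> /bij_inj/lker0P/lker0_lfunK. Qed.

(** The element that represents the identity of g in the tensor product of g and
    its dual does not depend on a basis; a pair of dual families need not even
    consist of independent elements for this. *)
Lemma casimir_dual_family (T : finType) (e c : T -> g) :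
  form_nondegenerate B -> (forall a, a = \sum_t B (c t) a *: e t) ->
  casimir dg br B = \sum_t env_in dg br (e t) * env_in dg br (c t).
Proof.
move=> ndB expand; rewrite /casimir.
pose v := vbasis {:g}.
have inv i : (form_map B)^-1%VF (linfun (coord v i : g -> k^o))
    = \sum_t coord v i (e t) *: c t.
  rewrite -[RHS](form_mapK ndB); congr (_ _); apply/lfunP=> a.
  rewrite lfunE /= {1}[a]expand !linear_sum sum_lfunE /=; apply: eq_bigr => t _.
  by rewrite !linearZ lfunE /= form_mapE; apply: mulrC.
under eq_bigr do rewrite inv linear_sum mulr_sumr.
rewrite exchange_big; apply: eq_bigr => t _ /=.
rewrite [in RHS](coord_vbasis (memvf (e t))) linear_sum mulr_suml.
apply: eq_bigr => i _.
rewrite !linearZ /=.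
exact: etrans (esym (quot_scaleAr _ _ _)) (quot_scaleAl _ _ _).
Qed.

End FormMap.

(** * Trace forms and invariant forms on gl(X) *)

Section GlTheory.
Context (k : fieldType) (k2 : 2%N \in [pchar k]) (X : ver4p k).
Implicit Types (u v : X) (f g : 'Hom(X, k^o)) (a b c A B : 'End(X)).

Local Notation d := (dif X).

Lemma gl_dif_is_linear : linear (@gl_dif k X).
Proof.
move=> c A B; rewrite /gl_dif comp_lfunDr comp_lfunDl -comp_lfunZr -comp_lfunZl.
by rewrite addrACA -scalerDr.
Qed.

HB.instance Definition _ :=
  GRing.isLinear.Build k 'End(X) 'End(X) _ (@gl_dif k X) gl_dif_is_linear.

Lemma gl_tr_is_linear : linear_for *%R (@gl_tr k X).
Proof.
move=> c A B; rewrite /gl_tr mulr_sumr -big_split; apply: eq_bigr => i _ /=.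
by rewrite !lfunE /= lfunE /= linearP.
Qed.

HB.instance Definition _ :=
  GRing.isLinear.Build k 'End(X) k _ (@gl_tr k X) gl_tr_is_linear.

Lemma gl_tr_outer u f : gl_tr (outer u f) = f u.
Proof.
rewrite [in RHS](coord_vbasis (memvf u)) linear_sum; apply: eq_bigr => i _.
by rewrite outerE !linearZ; apply: mulrC.
Qed.

Lemma gl_trC a b : gl_tr (a \o b)%VF = gl_tr (b \o a)%VF.
Proof.
pose e := vbasis {:X}.
have trE A B : gl_tr (A \o B)%VF =
    \sum_(i < \dim {:X}) \sum_(j < \dim {:X}) coord e j (B e`_i) * coord e i (A e`_j).
  rewrite /gl_tr; apply: eq_bigr => i _.
  rewrite lfunE /= [in LHS](coord_vbasis (memvf (B _))) !linear_sum.
  by apply: eq_bigr => j _; rewrite !linearZ.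
rewrite !trE exchange_big; apply: eq_bigr => i _; apply: eq_bigr => j _.
exact: mulrC.
Qed.

Lemma gl_tr_nondeg a : (forall b, gl_tr (a \o b)%VF = 0) -> a = 0.
Proof.
move=> a0; apply/lfunP=> u; rewrite lfunE /= (coord_vbasis (memvf (a u))).
apply: big1 => i _; have /eqP := a0 (outer u (linfun (coord (vbasis {:X}) i : X -> k^o))).
by rewrite comp_lfun_outer gl_tr_outer lfunE => /eqP /= ->; rewrite scale0r.
Qed.

Lemma gl_difM a b : gl_dif (a \o b)%VF = (gl_dif a \o b)%VF + (a \o gl_dif b)%VF.
Proof.
by rewrite /gl_dif !comp_lfunDl !comp_lfunDr !comp_lfunA addrA addvK2.
Qed.

Lemma gl_difK a : gl_dif (gl_dif a) = 0.
Proof. exact: gl_dif_sq. Qed.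

Lemma gl_tr_dif a : gl_tr (gl_dif a) = 0.
Proof. by rewrite raddfD /= gl_trC addrr_pchar2. Qed.

Lemma gl_brE a b : gl_br a b = (a \o b)%VF + (b \o a)%VF + (gl_dif b \o gl_dif a)%VF.
Proof. by rewrite /gl_br !oppv2. Qed.

Lemma gl_difD a b : gl_dif (a + b) = gl_dif a + gl_dif b.
Proof. exact: raddfD. Qed.

Lemma gl_trD a b : gl_tr (a + b) = gl_tr a + gl_tr b.
Proof. exact: raddfD. Qed.

Lemma gl_tr_br a b : gl_tr (gl_br a b) = 0.
Proof.
have -> : (gl_br a b = (a \o b)%VF + (b \o a)%VF + gl_dif (b \o gl_dif a)%VF).
  by rewrite gl_brE gl_difM gl_difK comp_lfun0r addr0.
by rewrite 2!gl_trD gl_tr_dif addr0 gl_trC addrr_pchar2.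
Qed.

(** The second summand is invariant because brackets and derivatives
    have trace 0. *)
Definition trace_form (mu nu : k) a b : k :=
  mu * gl_tr (a \o b)%VF + nu * (gl_tr a * gl_tr b).

Lemma trace_form_is_bilinear mu nu :
  bilinear_for (GRing.Scale.Law.clone _ _ *%R _)
    (GRing.Scale.Law.clone _ _ *%R _)
    (trace_form mu nu : 'End(X) -> 'End(X) -> k).
Proof.
split=> [c|c] s a b; rewrite /trace_form.
  by rewrite comp_lfunDl -comp_lfunZl !linearP /=; ring.
by rewrite comp_lfunDr -comp_lfunZr !linearP /=; ring.
Qed.

HB.instance Definition _ mu nu := bilinear_isBilinear.Build k 'End(X) 'End(X) k
  _ _ (trace_form mu nu) (trace_form_is_bilinear mu nu).

Lemma trace_form_sym mu nu a b : trace_form mu nu a b = trace_form mu nu b a.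
Proof. by rewrite /trace_form gl_trC [gl_tr a * _]mulrC. Qed.

Lemma trace_form_invariant mu nu : gl_invariant (trace_form mu nu).
Proof.
have two0 : 2%:R = 0 :> k := pcharf0 k2.
split=> [a b|a b c] /=; rewrite /trace_form.
  rewrite !gl_tr_dif mul0r mulr0 !mulr0 !addr0 -mulrDr -gl_trD -gl_difM.
  by rewrite gl_tr_dif mulr0.
rewrite !gl_tr_br gl_tr_dif !mul0r !mulr0 !addr0 -!mulrDr.
(* all terms occur twice, except two that form the derivative of b c a' *)
have /= : gl_tr (gl_dif (b \o (c \o gl_dif a)))%VF = 0 by apply: gl_tr_dif.
rewrite !gl_difM gl_difK comp_lfun0r addr0 !gl_trD => e.
rewrite !gl_brE gl_difK comp_lfun0r addr0.
move: (gl_dif a) (gl_dif b) (gl_dif c) e => a' b' c' /eqP.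
rewrite addr_eq0 oppr_pchar2 // => /eqP e.
rewrite !comp_lfunDl !comp_lfunDr !gl_trD -!comp_lfunA.
rewrite [gl_tr (a \o _)%VF]gl_trC -comp_lfunA e.
by apply: etrans (mulr0 mu); congr (_ * _); ring: two0.
Qed.

Section Invariant.
Context (B : {biscalar 'End(X)}) (invB : gl_invariant B).

Lemma form_dif a b : B (gl_dif a) b = B a (gl_dif b).
Proof.
by have /eqP := invB.1 a b; rewrite addr_eq0 oppr_pchar2 // => /eqP.
Qed.

(** Moving the derivative of b onto the bracket in the last term of the invariance
    condition merges that term with the second one. The result has no derivative
    of b on the right, so it applies to a functional B(b, -) with b fixed. *)
Lemma form_br a b c :
  B (gl_br a b) c
  = B b ((a \o c)%VF + (c \o a)%VF + (gl_dif a \o gl_dif c)%VF).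
Proof.
have := invB.2 a b c; rewrite form_dif [gl_br (gl_dif a) c]gl_brE gl_difK.
rewrite comp_lfun0r addr0 gl_difD !gl_difM gl_difK comp_lfun0l comp_lfun0r.
rewrite add0r addr0 -addrA -!linearDr => /(addv_eq0 (V := k^o) k2) ->; congr (B _ _).
by rewrite gl_brE addrACA addvv2 // addr0.
Qed.

End Invariant.

(** Brackets are required only with the element of I on the right, the side that
    [form_br] controls. *)
Definition braided_ideal (I : 'End(X) -> Prop) : Prop :=
  [/\ forall s a b, I a -> I b -> I (s *: a + b),
      forall a, I a -> I (gl_dif a) & forall a b, I b -> I (gl_br a b)].

(** For h the idempotent y (x) eta, the bracket of y (x) f with h is y (x) f up
    to a multiple of h and the correction y' (x) f', which vanishes if f' = 0;
    as f' is itself such a functional, differentiating y (x) f' shows that the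
    correction is in the ideal for every f. Likewise u (x) eta is in the ideal,
    and the bracket of u (x) eta with y (x) f is u (x) f up to multiples of h and
    its derivative. *)
Lemma idempotent_generates (I : 'End(X) -> Prop) (y : X) (eta : 'Hom(X, k^o)) :
  braided_ideal I -> eta y = 1 -> (eta \o d)%VF = 0 -> I (outer y eta) ->
  forall a, I a.
Proof.
move=> [Ilin Idif Ibr] eta_y eta_d Ih.
have eta_dif u : eta (d u) = 0 by rewrite -comp_lfunE eta_d lfunE.
have ID a b : I a -> I b -> I (a + b).
  by move=> Ia Ib; rewrite -[a]scale1r; apply: Ilin.
have I0 : I 0 by rewrite -(addvv2 k2 (outer y eta)); apply: ID.
have IZ s a : I a -> I (s *: a).
  by move=> Ia; rewrite -[_ *: a]addr0; apply: Ilin.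
have Icancel a b : I (a + b) -> I b -> I a.
  by move=> Iab Ib; rewrite -(addvK2 k2 a b); apply: ID.
have dif_h : gl_dif (outer y eta) = outer (d y) eta.
  by rewrite gl_dif_outer eta_d outer0r addr0.
have row_closed f : (f \o d)%VF = 0 -> I (outer y f).
  move=> f_d; have := Ibr (outer y f) _ Ih.
  rewrite gl_brE dif_h gl_dif_outer f_d outer0r addr0 !outerM eta_y scale1r.
  rewrite eta_dif scale0r addr0 addrC => If.
  by apply: (Icancel _ _ If); apply: IZ.
have row f : I (outer y f).
  have Ifd : I (outer (d y) (f \o d)%VF).
    have := Idif _ (row_closed _ (comp_dif_dif f)).
    by rewrite gl_dif_outer comp_dif_dif outer0r addr0.
  have := Ibr (outer y f) _ Ih.
  rewrite gl_brE dif_h gl_dif_outer comp_lfunDr !outerM eta_y !scale1r.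
  rewrite eta_dif scale0r add0r => If.
  apply: (Icancel _ (f y *: outer y eta)); last exact: IZ.
  by rewrite addrC; apply: Icancel If Ifd.
have col u : I (outer u eta).
  have := Ibr (outer u eta) _ Ih.
  rewrite gl_brE dif_h gl_dif_outer eta_d outer0r addr0 !outerM eta_y scale1r.
  rewrite eta_dif scale0r addr0 => Iu.
  by apply: (Icancel _ _ Iu); apply: IZ.
have rank1 u f : I (outer u f).
  have := Ibr (outer u eta) _ (row f).
  rewrite gl_brE !gl_dif_outer eta_d outer0r addr0 !outerM eta_y scale1r.
  rewrite comp_lfunDl !outerM comp_lfunE dif_dif linear0 scale0r addr0 -addrA => Iu.
  by apply: (Icancel _ _ Iu); apply: ID; apply: IZ; rewrite // -dif_h; apply: Idif.
move=> a; rewrite (outer_sum (vbasisP _) a).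
by elim/big_ind: _ => // i _; apply: rank1.
Qed.

Lemma form_agree_ideal (B1 B2 : {biscalar 'End(X)}) :
  gl_invariant B1 -> gl_invariant B2 ->
  braided_ideal (fun a => forall c, B1 a c = B2 a c).
Proof.
move=> inv1 inv2; split=> [s a b eqa eqb c|a eqa c|a b eqb c].
- by rewrite !linearPl /= eqa eqb.
- by rewrite !form_dif.
- by rewrite !form_br.
Qed.

End GlTheory.

(** * Matrix units in an adapted basis *)

Section AdaptedBasis.
Context (k : fieldType) (k2 : 2%N \in [pchar k]) (m n : nat) (X : ver4p k).
Context (x : m.-tuple X) (y : n.-tuple X) (Sbasis : adapted_basis x y).
Local Notation index := 'I_(m + (n + n)).
Implicit Types (z w : index) (i : 'I_m) (j : 'I_n).

Local Notation d := (dif X).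
Local Notation ix := (@ix m n).
Local Notation iy := (@iy m n).
Local Notation iy' := (@iy' m n).
Local Notation S := (tnth (adapted x y)).
Local Notation D := (dual x y).
Local Notation E := (unit_op x y).

Variant index_spec : index -> Type :=
| IndexX i : index_spec (ix i)
| IndexY j : index_spec (iy j)
| IndexY' j : index_spec (iy' j).

Lemma indexP z : index_spec z.
Proof.
case: (split_ordP z) => [i ->|z' ->]; first exact: IndexX.
by case: (split_ordP z') => [j ->|j ->]; [apply: IndexY | apply: IndexY'].
Qed.

Lemma index_eqE :
  ((forall i i', (ix i == ix i') = (i == i'))
   * (forall j j', (iy j == iy j') = (j == j'))
   * (forall j j', (iy' j == iy' j') = (j == j'))
   * (forall i j, (ix i == iy j) = false) * (forall i j, (iy j == ix i) = false)
   * (forall i j, (ix i == iy' j) = false) * (forall i j, (iy' j == ix i) = false)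
   * (forall j j', (iy j == iy' j') = false)
   * (forall j j', (iy' j == iy j') = false))%type.
Proof.
do !split=> *; rewrite /Defs.ix /Defs.iy /Defs.iy' ?eq_rshift ?eq_lshift
  ?eq_lrshift ?eq_rlshift //.
Qed.

Lemma dualE z w : D z (S w) = (z == w)%:R.
Proof.
have /andP [_ freeS] := Sbasis.2.
by rewrite lfunE /= (tnth_nth 0) coord_free // eq_sym.
Qed.

Lemma dual_ext (f g : 'Hom(X, k^o)) : (forall z, f (S z) = g (S z)) -> f = g.
Proof.
move=> fg; apply/lfunP=> u; rewrite (coord_basis Sbasis.2 (memvf u)) !linear_sum.
apply: eq_bigr => z _; rewrite !linearZ -!tnth_nth.
exact: congr1 (fg z).
Qed.

Lemma dif_x i : d (S (ix i)) = 0.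
Proof. by rewrite /Defs.ix tnth_lshift; apply: Sbasis.1. Qed.

Lemma dif_y j : d (S (iy j)) = S (iy' j).
Proof.
by rewrite /Defs.iy /Defs.iy' !tnth_rshift tnth_lshift tnth_map.
Qed.

Lemma dif_y' j : d (S (iy' j)) = 0.
Proof. by rewrite -dif_y dif_dif. Qed.

Definition dif_S := (dif_x, dif_y, dif_y').

Lemma dual_dif_x i : (D (ix i) \o d)%VF = 0.
Proof.
apply: dual_ext => z; rewrite comp_lfunE [RHS]lfunE /=.
by case: (indexP z) => j; rewrite !dif_S ?linear0 // dualE index_eqE.
Qed.

Lemma dual_dif_y j : (D (iy j) \o d)%VF = 0.
Proof.
apply: dual_ext => z; rewrite comp_lfunE [RHS]lfunE /=.
by case: (indexP z) => j'; rewrite !dif_S ?linear0 // dualE index_eqE.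
Qed.

Lemma dual_dif_y' j : (D (iy' j) \o d)%VF = D (iy j).
Proof.
apply: dual_ext => z; rewrite comp_lfunE [RHS]dualE.
by case: (indexP z) => j'; rewrite !dif_S ?linear0 ?index_eqE // dualE index_eqE.
Qed.

Definition dual_dif := (dual_dif_x, dual_dif_y, dual_dif_y').

Lemma unit_opM z w z' w' :
  (E z w \o E z' w')%VF = ((w == z')%:R : k) *: E z w'.
Proof. by rewrite /unit_op outerM dualE. Qed.

Lemma gl_tr_unit z w : gl_tr (E z w) = (z == w)%:R.
Proof. by rewrite gl_tr_outer dualE eq_sym. Qed.

Lemma unit_op_sum (a : 'End(X)) : a = \sum_z \sum_w (D z (a (S w)) : k) *: E z w.
Proof.
rewrite [LHS](outer_sum Sbasis.2 a) exchange_big; apply: eq_bigr => w _ /=.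
rewrite -[LHS]/(outer (a (S w)) (D w)).
have {1}-> : a (S w) = \sum_z (D z (a (S w)) : k) *: S z.
  rewrite [LHS](coord_basis Sbasis.2 (memvf _)).
  by apply: eq_bigr => z _; rewrite lfunE -tnth_nth.
rewrite linear_sumlz; apply: eq_bigr => z _; exact: linearZl_LR.
Qed.

Lemma id_unit_sum : \1%VF = \sum_z E z z.
Proof.
rewrite [LHS](outer_sum Sbasis.2 \1%VF); apply: eq_bigr => z _.
by rewrite id_lfunE.
Qed.

Lemma gl_tr1 : gl_tr (\1%VF : 'End(X)) = m%:R.
Proof.
rewrite id_unit_sum raddf_sum /=.
under eq_bigr do rewrite gl_tr_unit eqxx.
by rewrite sumr_const card_ord !natrD addrr_pchar2 // addr0.
Qed.

Lemma gl_dif_unit z w :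
  gl_dif (E z w) = outer (d (S z)) (D w) + outer (S z) (D w \o d)%VF.
Proof. exact: gl_dif_outer. Qed.

Lemma gl_dif_xx i i' : gl_dif (E (ix i) (ix i')) = 0.
Proof. by rewrite gl_dif_unit dif_x dual_dif_x outer0l outer0r addr0. Qed.

Lemma gl_dif_xy i j : gl_dif (E (ix i) (iy j)) = 0.
Proof. by rewrite gl_dif_unit dif_x dual_dif_y outer0l outer0r addr0. Qed.

Lemma gl_dif_y'x j i : gl_dif (E (iy' j) (ix i)) = 0.
Proof. by rewrite gl_dif_unit dif_y' dual_dif_x outer0l outer0r addr0. Qed.

Lemma gl_dif_y'y j j' : gl_dif (E (iy' j) (iy j')) = 0.
Proof. by rewrite gl_dif_unit dif_y' dual_dif_y outer0l outer0r addr0. Qed.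

Lemma gl_dif_yy j j' : gl_dif (E (iy j) (iy j')) = E (iy' j) (iy j').
Proof. by rewrite gl_dif_unit dif_y dual_dif_y outer0r addr0. Qed.

Lemma gl_dif_y'y' j j' : gl_dif (E (iy' j) (iy' j')) = E (iy' j) (iy j').
Proof. by rewrite gl_dif_unit dif_y' dual_dif_y' outer0l add0r. Qed.

Lemma gl_dif_yy' j j' :
  gl_dif (E (iy j) (iy' j')) = E (iy j) (iy j') + E (iy' j) (iy' j').
Proof. by rewrite gl_dif_unit dif_y dual_dif_y' addrC. Qed.

Lemma dual_dif_self z : D z (d (S z)) = 0.
Proof.
by case: (indexP z) => j; rewrite !dif_S ?linear0 // dualE index_eqE.
Qed.

Lemma outer_dif_self z : outer (d (S z)) (D z \o d)%VF = 0.
Proof.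
by case: (indexP z) => j; rewrite ?dif_S ?dual_dif ?outer0l ?outer0r.
Qed.

Lemma unit_dif_dif z w : (gl_dif (E z w) \o gl_dif (E w z))%VF = 0.
Proof.
rewrite !gl_dif_unit comp_lfunDl !comp_lfunDr !outerM !comp_lfunE dif_dif linear0.
rewrite dual_dif_self dualE eqxx !scale0r scale1r outer_dif_self.
by rewrite !addr0.
Qed.

(** * Classification of the invariant forms *)

Section FormClassification.
Context (B : {biscalar 'End(X)}) (invB : gl_invariant B) (jn : 'I_n).

Local Notation h := (E (iy jn) (iy jn)).

(** With a = E_zz, which brackets h to 0, and c = E_zw, the identity [form_br]
    trades E_zw for the image of a'c', which is again 0 or a matrix unit off the
    diagonal, this time at a row killed by the differential; there one more step
    gives 0. *)
Lemma form_h_offdiag z w : z != w -> B h (E z w) = 0.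
Proof.
have red z' w' : z' != w' ->
    B h (E z' w') = B h (outer (d (S z')) (D w' \o d)%VF).
  move=> zw; have := form_br k2 invB (E z' z') h (E z' w').
  have -> : gl_br (E z' z') h = 0.
    rewrite gl_brE // !unit_opM gl_dif_yy gl_dif_unit comp_lfunDr !outerM.
    rewrite -comp_lfunE dual_dif_y zero_lfunE scale0r add0r dualE eq_sym.
    case: eqVneq => [<-|_]; last by rewrite !scale0r !addr0.
    by rewrite dual_dif_y outer0r !scale1r addr0 addvv2.
  rewrite linear0l linearDr => /esym/(addv_eq0 (V := k^o) k2).
  rewrite !unit_opM eqxx scale1r [w' == z']eq_sym (negPf zw) scale0r addr0 => ->.
  rewrite !gl_dif_unit comp_lfunDl !comp_lfunDr !outerM.
  rewrite !comp_lfunE dif_dif linear0 dual_dif_self dualE eqxx !scale0r scale1r.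
  by rewrite add0r !addr0.
move=> zw; rewrite red //.
case: (indexP z) zw => [i|j|j] zw; rewrite ?dif_S ?outer0l ?linear0r //.
case: (indexP w) zw => [i|j'|j'] zw; rewrite ?dual_dif ?outer0r ?linear0r //.
rewrite -[outer _ _]/(E (iy' j) (iy j')) red ?index_eqE //.
by rewrite dif_y' outer0l linear0r.
Qed.

(** For z and w different from y_n the operator a = E_zw brackets h to 0, and
    with c = E_wz the product a'c' is 0, so that ac + ca + a'c' = E_zz + E_ww. *)
Lemma form_h_diag z w : z != iy jn -> w != iy jn -> B h (E z z) = B h (E w w).
Proof.
move=> zy wy; case: (eqVneq z w) => [-> //|zw].
have := form_br k2 invB (E z w) h (E w z).
have -> : gl_br (E z w) h = 0.
  rewrite gl_brE // !unit_opM gl_dif_yy gl_dif_unit comp_lfunDr !outerM.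
  rewrite -comp_lfunE dual_dif_y zero_lfunE dualE (negPf wy).
  by rewrite ![iy jn == z]eq_sym (negPf zy) !scale0r !addr0.
rewrite linear0l !unit_opM !eqxx !scale1r unit_dif_dif addr0 linearDr => /esym.
exact: (addv_eq0 (V := k^o) k2).
Qed.

(** The parameter nu is read off at y_n', a diagonal place outside h that exists
    whatever m is. *)
Lemma form_h_unit z w : B h (E z w) =
  trace_form (B h h - B h (E (iy' jn) (iy' jn)))
    (B h (E (iy' jn) (iy' jn))) h (E z w).
Proof.
set nu := B h (E (iy' jn) _); rewrite /trace_form unit_opM linearZ /= !gl_tr_unit eqxx.
rewrite mul1r; have [<-{w}|zw] := eqVneq z w.
  have [->|zy] := eqVneq z (iy jn); first by rewrite !mulr1 subrK.
  by rewrite mul0r mulr0 add0r mulr1; apply: form_h_diag; rewrite ?index_eqE.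
rewrite form_h_offdiag // mulr0 addr0.
have [->|_] := eqVneq (iy jn) z; last by rewrite mul0r mulr0.
by rewrite (negPf zw) !mulr0.
Qed.

Lemma invariant_trace_form :
  exists mu nu, forall a b, B a b = trace_form mu nu a b.
Proof.
set nu := B h (E (iy' jn) (iy' jn)); exists (B h h - nu), nu.
have agree := form_agree_ideal k2 invB (trace_form_invariant k2 X (B h h - nu) nu).
have one : D (iy jn) (S (iy jn)) = 1 by rewrite dualE eqxx.
apply: (idempotent_generates k2 agree one (dual_dif_y jn)) => c.
rewrite [c]unit_op_sum !linear_sumr; apply: eq_bigr => z _.
rewrite !linear_sumr; apply: eq_bigr => w _.
rewrite [LHS]linearZr_LR [RHS]linearZr_LR; congr (_ * _).
exact: form_h_unit.
Qed.

End FormClassification.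

Section FormParameters.
Context (jn : 'I_n).

Lemma trace_form_h mu nu :
  trace_form mu nu (E (iy jn) (iy jn)) (E (iy jn) (iy jn)) = mu + nu.
Proof. by rewrite /trace_form unit_opM eqxx scale1r gl_tr_unit eqxx !mulr1. Qed.

Lemma in_sl_unit z w : z != w -> in_sl (E z w).
Proof. by move=> zw; rewrite /in_sl gl_tr_unit (negPf zw). Qed.

Lemma gl_tr_hyperbolic z w : @gl_tr k X (E z w \o E w z)%VF = 1.
Proof. by rewrite unit_opM eqxx scale1r gl_tr_unit eqxx. Qed.

Lemma trace_form_hyperbolic mu nu z w : z != w ->
  trace_form mu nu (E z w) (E w z) = mu.
Proof.
move=> zw; rewrite /trace_form gl_tr_hyperbolic (in_sl_unit zw) mul0r mulr0.
by rewrite addr0 mulr1.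
Qed.

Lemma trace_form_on_sl mu nu : form_on_sl mu (trace_form mu nu : {biscalar 'End(X)}).
Proof. by move=> a b a0 _; rewrite /= /trace_form a0 mul0r mulr0 addr0. Qed.

Lemma trace_form1 mu nu (a : 'End(X)) :
  trace_form mu nu \1%VF a = (mu + m%:R * nu) * gl_tr a.
Proof. by rewrite /trace_form comp_lfun1l gl_tr1; ring. Qed.

Lemma y_neq_y' j j' : iy j != iy' j'.
Proof. by rewrite index_eqE. Qed.

(** Both normalisations describe the same family: lam is mu + nu, the value at
    (h, h), and mu is the value at a pair of transposed matrix units. *)
Lemma classified_trace_form (P : k -> k -> {biscalar 'End(X)} -> Prop) :
  (forall lam mu B, gl_invariant B ->
     P lam mu B <-> forall a b, B a b = trace_form mu (lam + mu) a b) ->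
  classified (@gl_dif k X) (@gl_br k X) P.
Proof.
move=> PE; split=> [lam mu|B invB].
  exists (trace_form mu (lam + mu)); split; first exact: trace_form_invariant.
    by apply/PE => //; apply: trace_form_invariant.
  by move=> B invB /(PE _ _ _ invB).
have [mu [nu BE]] := invariant_trace_form invB jn.
exists (mu + nu, mu); split=> [|[lam' mu'] /(PE _ _ _ invB) /= BE'].
  by apply/PE => //= a b; rewrite BE [mu + nu]addrC -addrA addrr_pchar2 // addr0.
have zw := y_neq_y' jn jn.
have := BE (E (iy jn) (iy jn)) (E (iy jn) (iy jn)).
have := BE (E (iy jn) (iy' jn)) (E (iy' jn) (iy jn)).
rewrite !BE' !trace_form_h !trace_form_hyperbolic // => -> <-.
by rewrite addrCA addrr_pchar2 // addr0.
Qed.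

Lemma form_oddP (oddm : odd m) lam mu (B : {biscalar 'End(X)}) :
  gl_invariant B ->
  form_odd lam mu B <-> forall a b, B a b = trace_form mu (lam + mu) a b.
Proof.
move=> invB; have m1 : m%:R = 1 :> k by rewrite natr_parity // oddm.
split=> [[Bsl B11 _]|BE].
  have [mu' [nu BE]] := invariant_trace_form invB jn.
  have zw := y_neq_y' jn jn; have wz := zw; rewrite eq_sym in wz.
  have := Bsl _ _ (in_sl_unit zw) (in_sl_unit wz).
  rewrite BE trace_form_hyperbolic // gl_tr_hyperbolic mulr1 => <-.
  move: B11; rewrite BE trace_form1 gl_tr1 m1 mul1r mulr1 => <- a b.
  by rewrite [mu' + nu]addrC -addrA addrr_pchar2 // addr0.
split=> [a b a0 b0||a a0]; rewrite BE; first exact: trace_form_on_sl.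
  by rewrite trace_form1 gl_tr1 m1 mul1r mulr1 addrCA addrr_pchar2 // addr0.
by rewrite trace_form1 a0 mulr0.
Qed.

Lemma form_evenP (evenm : ~~ odd m) lam mu (B : {biscalar 'End(X)}) :
  gl_invariant B ->
  form_even x y jn lam mu B <-> forall a b, B a b = trace_form mu (lam + mu) a b.
Proof.
move=> invB; have m0 : m%:R = 0 :> k by rewrite natr_parity // (negPf evenm).
have zw := y_neq_y' jn jn; have wz := zw; rewrite eq_sym in wz.
split=> [[Bsl Bhh _ _ _]|BE].
  have [mu' [nu BE]] := invariant_trace_form invB jn.
  have := Bsl _ _ (in_sl_unit zw) (in_sl_unit wz).
  rewrite BE trace_form_hyperbolic // gl_tr_hyperbolic mulr1 => <-.
  move: Bhh; rewrite BE trace_form_h => <- a b.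
  by rewrite [mu' + nu]addrC -addrA addrr_pchar2 // addr0.
split=> [a b a0 b0||||]; rewrite ?BE; first exact: trace_form_on_sl.
- by rewrite trace_form_h addrCA addrr_pchar2 // addr0.
- by rewrite trace_form_sym trace_form1 m0 mul0r addr0 gl_tr_unit eqxx mulr1.
- move=> z w zw'; rewrite BE /trace_form unit_opM linearZ /= !gl_tr_unit.
  rewrite (negPf zw') !mulr0 addr0; have [->|_] := eqVneq (iy jn) z.
    by rewrite (negPf zw') !mulr0.
  by rewrite mul0r mulr0.
move=> z zy; rewrite BE /trace_form comp_lfunDr !unit_opM !gl_trD !gl_tr_unit.
rewrite !eqxx addrr_pchar2 // mulr0 mulr0 addr0 [iy jn == z]eq_sym (negPf zy).
by rewrite (negPf zw) !scale0r !linear0 addr0 mulr0.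
Qed.

End FormParameters.

(** * Nondegeneracy and the dual of the matrix units *)

Section TraceFormDuality.
Context (jn : 'I_n) (mu nu : k) (B : {biscalar 'End(X)}).
Context (BE : forall a b, B a b = trace_form mu nu a b).

Lemma trace_form_nondegenerateP :
  form_nondegenerate B <-> mu != 0 /\ mu + m%:R * nu != 0.
Proof.
have zw := y_neq_y' jn jn.
rewrite form_nondegenerateP; split=> [B0|[mu0 dn0] a a0].
  split; apply/eqP=> c0.
    have e0 : E (iy jn) (iy' jn) = 0.
      by apply: B0 => b; rewrite BE /trace_form c0 (in_sl_unit zw) !(mul0r, mulr0) addr0.
    have /eqP := gl_tr_hyperbolic (iy jn) (iy' jn).
    by rewrite e0 comp_lfun0l linear0 eq_sym oner_eq0.
  have id0 : \1%VF = 0 :> 'End(X).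
    by apply: B0 => b; rewrite BE trace_form1 c0 mul0r.
  have /eqP := gl_tr_hyperbolic (iy jn) (iy' jn).
  by rewrite -[X in gl_tr X]comp_lfun1l id0 comp_lfun0l linear0 eq_sym oner_eq0.
have tr0 : gl_tr a = 0.
  have /eqP := a0 \1%VF; rewrite BE trace_form_sym trace_form1 mulf_eq0 (negPf dn0).
  by move/eqP.
apply: gl_tr_nondeg => b; have /eqP := a0 b.
by rewrite BE /trace_form tr0 mul0r mulr0 addr0 mulf_eq0 (negPf mu0) => /eqP.
Qed.

(** The correction by the identity compensates the term nu Tr Tr, which pairs a
    diagonal matrix unit with the whole diagonal. *)
Definition dual_op (p : index * index) : 'End(X) :=
  mu^-1 *: E p.2 p.1
  + ((p.1 == p.2)%:R * (nu / (mu * (mu + m%:R * nu)))) *: \1%VF.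

Lemma dual_op_expand (ndB : form_nondegenerate B) a :
  a = \sum_p B (dual_op p) a *: E p.1 p.2.
Proof.
have [mu0 dn0] := trace_form_nondegenerateP.1 ndB.
rewrite [LHS]unit_op_sum pair_big; apply: eq_bigr => -[z w] _ /=.
congr (_ *: _); rewrite BE linearDl !linearZl_LR /= trace_form1.
rewrite /trace_form gl_tr_unit outer_comp_lfun gl_tr_outer comp_lfunE.
rewrite [w == z]eq_sym; move: (D z (a (S w)) : k) (gl_tr a) (_ == _) => v r e.
transitivity (v + (e%:R * nu * r / mu + e%:R * nu * r / mu)).
  by rewrite addrr_pchar2 // addr0.
by field; rewrite mu0 dn0.
Qed.

End TraceFormDuality.

End AdaptedBasis.

(** * Computations in the enveloping algebra *)

(** In characteristic two no factor 1/2 can be put in front of a symmetric double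
    sum, so the indices are ordered instead. *)
Lemma sum_pairs (V : nmodType) r (F : 'I_r -> 'I_r -> V) :
  \sum_z \sum_w F z w
  = \sum_z F z z + \sum_(z < r) \sum_(w < r | (z < w)%N) (F z w + F w z).
Proof.
have -> : \sum_z \sum_w F z w = \sum_(z < r) (F z z +
    (\sum_(w < r | (z < w)%N) F z w + \sum_(w < r | (w < z)%N) F z w)).
  apply: eq_bigr => z _; rewrite (bigD1 z) //=; congr (_ + _).
  rewrite (bigID (fun w : 'I_r => (z < w)%N)) /=.
  congr (_ + _); apply: eq_bigl => w; rewrite -val_eqE /=; last by case: (ltngtP w z).
  by case: (ltngtP w z).
rewrite !big_split /=; congr (_ + _).
rewrite [X in _ + X](exchange_big_dep xpredT) //= -big_split /=.
by apply: eq_bigr => z _; rewrite -big_split.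
Qed.

(** The computations use only that u satisfies the relations of the enveloping
    algebra, so they are carried out for any such additive map into a ring in
    which 2 = 0. *)
Section Representation.
Context (k : fieldType) (k2 : 2%N \in [pchar k]) (m n : nat) (X : ver4p k).
Context (x : m.-tuple X) (y : n.-tuple X) (Sbasis : adapted_basis x y).
Context (U : pzRingType) (U2 : forall v : U, v + v = 0).
Context (u : {additive 'End(X) -> U}).
Context (u_br : forall a b,
  u a * u b - u b * u a - u (gl_dif b) * u (gl_dif a) = u (gl_br a b)).
Local Notation index := 'I_(m + (n + n)).
Implicit Types (a b : 'End(X)) (z w : index) (i : 'I_m) (j : 'I_n).

Local Notation ix := (@ix m n).
Local Notation iy := (@iy m n).
Local Notation iy' := (@iy' m n).
Local Notation E := (unit_op x y).

Lemma rep_cancel (v w : U) : v + w = 0 -> v = w.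
Proof. by move=> vw; rewrite -[LHS]addr0 -(U2 w) addrA vw add0r. Qed.

Lemma rep_swap a b :
  u a * u b + u b * u a = u (gl_dif b) * u (gl_dif a) + u (gl_br a b).
Proof.
rewrite -u_br; have opp (v : U) : - v = v.
  by apply: rep_cancel; rewrite addNr.
by rewrite !opp [RHS]addrC -addrA U2 addr0.
Qed.

(** In the relation for the pair (a, a) the two products of a with itself cancel,
    in the ring as well as in the bracket. *)
Lemma rep_dif_sq a : u (gl_dif a) * u (gl_dif a) = u (gl_dif a \o gl_dif a)%VF.
Proof.
have /esym := rep_swap a a.
by rewrite U2 gl_brE // (addvv2 k2) add0r => /rep_cancel.
Qed.

Lemma rep_closed_swap a b :
  gl_dif a = 0 -> u a * u b + u b * u a = u ((a \o b)%VF + (b \o a)%VF).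
Proof.
by move=> a0; rewrite rep_swap gl_brE // a0 comp_lfun0r addr0 raddf0 mulr0 add0r.
Qed.

Lemma rep_sqrD a b :
  u (a + b) * u (a + b) = u a * u a + u b * u b + (u a * u b + u b * u a).
Proof.
by rewrite raddfD mulrDl !mulrDr [u b * u a + _]addrC addrACA.
Qed.

(** P is the projection onto the span of the x_i, and the derivative of F is the
    complementary projection, onto the copies of the projective object. *)
Let F := \sum_j E (iy j) (iy' j).
Let P := \sum_i E (ix i) (ix i).

Lemma id_split : \1%VF = P + gl_dif F.
Proof.
rewrite (id_unit_sum Sbasis) !big_split_ord /= raddf_sum /=; congr (_ + _).
by rewrite -big_split; apply: eq_bigr => j _; rewrite gl_dif_yy'.
Qed.

Lemma rep_P_sq : u P * u P = \sum_i u (E (ix i) (ix i)) * u (E (ix i) (ix i)).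
Proof.
rewrite /P raddf_sum mulr_suml /=.
under eq_bigr do rewrite mulr_sumr.
rewrite sum_pairs [X in _ + X]big1 ?addr0 // => i _; apply: big1 => i' ii'.
have ne : i != i' by rewrite neq_ltn ii'.
rewrite rep_closed_swap ?gl_dif_xx // !(unit_opM Sbasis) !index_eqE.
rewrite [i' == i]eq_sym !(negPf ne).
by rewrite !scale0r addr0 raddf0.
Qed.

Lemma comp_PP : (P \o P)%VF = P.
Proof.
rewrite {2}/P (big_morph (comp_lfun P) (comp_lfunDr P) (comp_lfun0r X P)).
apply: eq_bigr => i _; rewrite comp_lfun_outer sum_lfunE (bigD1 i) //=.
rewrite big1 ?addr0 => [|i' /negPf ii']; rewrite outerE dualE // index_eqE.
  by rewrite eqxx scale1r.
by rewrite ii' scale0r.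
Qed.

(** P is closed, so the mixed products with its complement add up to the image of
    the products of the two complementary projections, which are 0. *)
Lemma rep_id_sq : u \1%VF * u \1%VF =
  \sum_i u (E (ix i) (ix i)) * u (E (ix i) (ix i)) + u (gl_dif F).
Proof.
have dP : gl_dif P = 0 by rewrite raddf_sum big1 // => i _; apply: gl_dif_xx.
have dF : gl_dif F = \1%VF + P by rewrite id_split [P + _]addrC addvK2.
rewrite {1 2}id_split rep_sqrD rep_P_sq rep_dif_sq rep_closed_swap // dF.
rewrite !comp_lfunDl !comp_lfunDr !comp_lfun1l !comp_lfun1r comp_PP.
by rewrite !(addvv2 k2) !raddf0 !addr0.
Qed.

(** For each j the matrix units at y_j and y_j' add up to a derivative, whose
    square is linear by [rep_dif_sq]; their mixed products add up to the square of
    the common derivative E_(y_j', y_j), which is 0. *)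
Lemma rep_diag_sq : \sum_z u (E z z) * u (E z z) =
  \sum_i u (E (ix i) (ix i)) * u (E (ix i) (ix i)) + u (gl_dif F).
Proof.
rewrite !big_split_ord /=; congr (_ + _); rewrite -big_split !raddf_sum /=.
apply: eq_bigr => j _.
have e2 : u (E (iy' j) (iy j)) * u (E (iy' j) (iy j)) = 0.
  by rewrite -(gl_dif_yy Sbasis) rep_dif_sq gl_dif_yy // unit_opM // index_eqE scale0r raddf0.
have := rep_dif_sq (E (iy j) (iy' j)); rewrite gl_dif_yy' // rep_sqrD rep_swap.
rewrite gl_brE // gl_dif_yy // gl_dif_y'y' // e2 comp_lfunDl !comp_lfunDr.
rewrite !unit_opM // !index_eqE !eqxx !scale0r !scale1r !addr0 !add0r raddf0.
by rewrite !addr0; apply.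
Qed.

(** A summand is nonzero only if z and w are both of type y or both of type y',
    and the summands at (y_i, y_j) and (y_i', y_j') are equal. *)
Lemma rep_dif_pairs : \sum_(z < m + (n + n)) \sum_(w < m + (n + n) | (z < w)%N)
    u (gl_dif (E w z)) * u (gl_dif (E z w)) = 0.
Proof.
pose G z w := u (gl_dif (E w z)) * u (gl_dif (E z w)).
have zero_l z w : gl_dif (E w z) = 0 -> G z w = 0.
  by rewrite /G => ->; rewrite raddf0 mul0r.
have zero_r z w : gl_dif (E z w) = 0 -> G z w = 0.
  by rewrite /G => ->; rewrite raddf0 mulr0.
pose A z w := if (z < w)%N then G z w else 0.
have A0 z w : G z w = 0 -> A z w = 0 by rewrite /A => ->; case: ifP.
have Axw i w : A (ix i) w = 0.
  apply: A0; case: (indexP w) => j.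
  - exact/zero_l/gl_dif_xx.
  - exact/zero_r/gl_dif_xy.
  - exact/zero_l/gl_dif_y'x.
have Ayx i j : A (iy j) (ix i) = 0 by apply/A0/zero_l/gl_dif_xy.
have Ay'x i j : A (iy' j) (ix i) = 0 by apply/A0/zero_r/gl_dif_y'x.
have Ayy' j j' : A (iy j) (iy' j') = 0 by apply/A0/zero_l/gl_dif_y'y.
have Ay'y j j' : A (iy' j) (iy j') = 0 by apply/A0/zero_r/gl_dif_y'y.
have Aeq j j' : A (iy' j) (iy' j') = A (iy j) (iy j').
  by rewrite /A /G !gl_dif_yy // !gl_dif_y'y' //= !ltn_add2l.
transitivity (\sum_z \sum_w A z w).
  by apply: eq_bigr => z _; rewrite big_mkcond.
rewrite !big_split_ord /= big1 ?add0r => [|i _]; last by apply: big1 => w _; apply: Axw.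
rewrite -big_split; apply: big1 => j _; rewrite !big_split_ord /=.
rewrite [X in X + _ + _ = _]big1 => [|i _]; last exact: Ayx.
rewrite [X in _ + (X + _) = _]big1 => [|i _]; last exact: Ay'x.
rewrite [X in _ + (_ + X) + _ = _]big1 => [|j' _]; last exact: Ayy'.
rewrite [X in _ + (_ + (X + _)) = _]big1 => [|j' _]; last exact: Ay'y.
rewrite !add0r addr0; under [X in _ + X]eq_bigr => j' _ do rewrite Aeq.
exact: U2.
Qed.

(** Off the diagonal the summands for (z, w) and (w, z) add up to E_zz + E_ww and
    a product of derivatives. Each E_zz occurs m + 2n - 1 times, which has the
    parity of m + 1. *)
Lemma rep_quadratic : \sum_z \sum_w u (E z w) * u (E w z) =
  \sum_z u (E z z) * u (E z z) + u \1%VF *+ m.+1.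
Proof.
rewrite sum_pairs; congr (_ + _).
have pair z w : (z < w)%N -> u (E z w) * u (E w z) + u (E w z) * u (E z w)
    = u (gl_dif (E w z)) * u (gl_dif (E z w)) + (u (E z z) + u (E w w)).
  move=> _; rewrite rep_swap gl_brE // !unit_opM // !eqxx !scale1r.
  by rewrite unit_dif_dif // addr0; congr (_ + _); apply: raddfD.
under eq_bigr => z _ do rewrite (eq_bigr _ (pair z)) big_split /=.
rewrite big_split /= rep_dif_pairs add0r.
have id_sum : u \1%VF = \sum_z u (E z z) by rewrite (id_unit_sum Sbasis) raddf_sum.
set pairs := LHS; have : u \1%VF *+ (m + (n + n)) = u \1%VF + pairs.
  rewrite [X in X *+ _]id_sum [X in X + _]id_sum.
  rewrite -(sum_pairs (fun z w => u (E z z))) -sumrMnl.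
  by apply: eq_bigr => z _; rewrite sumr_const card_ord.
rewrite !mulrnDr -mulrnDl U2 mul0rn addr0 mulrS => ->.
by rewrite addrA U2 add0r.
Qed.

Let quad := \sum_i (u (E (ix i) (ix i)) ^+ 2 + u (E (ix i) (ix i))).
Let lin := \sum_z u (E z z).

Lemma rep_id : u \1%VF = lin.
Proof. by rewrite (id_unit_sum Sbasis) raddf_sum. Qed.

Lemma rep_diag_mul v : \sum_z u (E z z) * v = u \1%VF * v.
Proof. by rewrite rep_id /lin mulr_suml. Qed.

Lemma quad_lin : quad + lin =
  \sum_i u (E (ix i) (ix i)) * u (E (ix i) (ix i)) + u (gl_dif F).
Proof.
rewrite /quad big_split /= -rep_id id_split -addrA; congr (_ + _).
have -> : u (P + gl_dif F) = u P + u (gl_dif F) by apply: raddfD.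
by rewrite addrA raddf_sum U2 add0r.
Qed.

Lemma rep_id_sq_quad_lin : u \1%VF * u \1%VF = quad + lin.
Proof. by rewrite rep_id_sq quad_lin. Qed.

Lemma rep_quadratic_quad_lin : \sum_z \sum_w u (E z w) * u (E w z) =
  quad + lin + lin *+ m.+1.
Proof. by rewrite rep_quadratic rep_diag_sq quad_lin rep_id. Qed.

End Representation.

(** * The Casimir element *)

Section CasimirElement.
Context (k : fieldType) (k2 : 2%N \in [pchar k]) (m n : nat) (X : ver4p k).
Context (x : m.-tuple X) (y : n.-tuple X) (Sbasis : adapted_basis x y).
Context (jn : 'I_n).

Local Notation E := (unit_op x y).
Local Notation u := (@gl_in k X).
Local Notation U := (gl_env X).

Lemma gl_env_add2 (v : U) : v + v = 0.
Proof. exact: addvv2. Qed.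

Lemma sum_quad_lin (V : lmodType k) (q l : V) s t r :
  s *: (q + l + l *+ r) + t *: (q + l)
  = (s + t) *: q + (s + t + s * r%:R) *: l.
Proof.
rewrite -scaler_nat !scalerDr !scalerDl scalerA -!addrA; congr (_ + _).
by rewrite [_ + (t *: q + _)]addrCA [LHS]addrCA [(s * r%:R) *: l + _]addrC.
Qed.

Lemma casimir_trace_form mu nu (B : {biscalar 'End(X)})
    (c := mu^-1 + nu / (mu * (mu + m%:R * nu))) :
  (forall a b, B a b = trace_form mu nu a b) -> form_nondegenerate B ->
  gl_casimir B
  = c *: casimir_quad x y + (c + mu^-1 * m.+1%:R) *: casimir_lin x y.
Proof.
move=> BE ndB.
have expand := dual_op_expand k2 Sbasis jn BE ndB.
rewrite -sum_quad_lin.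
rewrite -(rep_quadratic_quad_lin k2 Sbasis gl_env_add2 (@gl_in_rel k X)).
rewrite -(rep_id_sq_quad_lin k2 Sbasis gl_env_add2 (@gl_in_rel k X)).
rewrite [LHS](casimir_dual_family (@gl_dif k X) (@gl_br k X) ndB expand).
set t0 := nu / _.
have scaleAr r (v w : U) : v * (r *: w) = r *: (v * w).
  exact: esym (quot_scaleAr _ _ _).
have term (p : 'I_(m + (n + n)) * 'I_(m + (n + n))) :
    u (E p.1 p.2) * u (dual_op x y mu nu p)
    = mu^-1 *: (u (E p.1 p.2) * u (E p.2 p.1))
      + ((p.1 == p.2)%:R * t0) *: (u (E p.1 p.2) * u \1%VF).
  have -> : u (dual_op x y mu nu p)
      = mu^-1 *: u (E p.2 p.1) + ((p.1 == p.2)%:R * t0) *: u \1%VF.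
    by rewrite /dual_op linearD !linearZ.
  exact: etrans (mulrDr _ _ _) (congr2 +%R (scaleAr _ _ _) (scaleAr _ _ _)).
transitivity (\sum_p (mu^-1 *: (u (E p.1 p.2) * u (E p.2 p.1))
      + ((p.1 == p.2)%:R * t0) *: (u (E p.1 p.2) * u \1%VF))).
  by apply: eq_bigr => p _; apply: term.
rewrite big_split /=; congr (_ + _).
  rewrite scaler_sumr -(pair_bigA _ (fun z w => mu^-1 *: (u (E z w) * u (E w z)))).
  by apply: eq_bigr => z _; rewrite scaler_sumr.
rewrite -(pair_bigA _ (fun z w => ((z == w)%:R * t0) *: (u (E z w) * u \1%VF))).
rewrite -[X in _ = _ *: X](rep_diag_mul Sbasis).
rewrite scaler_sumr; apply: eq_bigr => z _ /=.
rewrite (bigD1 z) //= eqxx mul1r big1 ?addr0 // => w /negPf wz.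
by rewrite eq_sym wz mul0r scale0r.
Qed.

End CasimirElement.

Theorem theorem6p2 (k : closedFieldType) (k2 : 2%N \in [pchar k])
    (m n : nat) (n_gt0 : (0 < n)%N)
    (X : ver4p k) (x : m.-tuple X) (y : n.-tuple X)
    (Sbasis : adapted_basis x y) :
  (odd m ->
     classified (@gl_dif k X) (@gl_br k X) (@form_odd k X)
     /\ forall (lam mu : k) (B : {biscalar 'End(X)}),
          gl_invariant B ->
          form_odd lam mu B ->
          [/\ form_symmetric B,
              lam != 0 -> mu != 0 -> form_nondegenerate B &
              form_nondegenerate B ->
              gl_casimir B
              = lam^-1 *: casimir_quad x y + lam^-1 *: casimir_lin x y])
  /\
  (~~ odd m ->
     classified (@gl_dif k X) (@gl_br k X) (form_even x y (last_ord n_gt0))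
     /\ forall (lam mu : k) (B : {biscalar 'End(X)}),
          gl_invariant B ->
          form_even x y (last_ord n_gt0) lam mu B ->
          [/\ form_symmetric B,
              mu != 0 -> form_nondegenerate B &
              form_nondegenerate B ->
              gl_casimir B
              = (lam / mu ^+ 2) *: casimir_quad x y
                + ((lam + mu) / mu ^+ 2) *: casimir_lin x y]).
Proof.
have jn := last_ord n_gt0.
have muD (lam mu : k) : mu + (lam + mu) = lam.
  by rewrite addrCA addrr_pchar2 // addr0.
split=> parity; split.
- apply: (classified_trace_form k2 Sbasis jn) => lam mu B.
  exact: (form_oddP k2 Sbasis jn parity).
- move=> lam mu B invB /(form_oddP k2 Sbasis jn parity _ _ invB) BE.
  have m1 : m%:R = 1 :> k by rewrite natr_parity // parity.
  have ndE := trace_form_nondegenerateP k2 Sbasis jn BE.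
  rewrite m1 mul1r muD in ndE.
  split=> [a b|lam0 mu0|ndB]; first by rewrite !BE trace_form_sym.
    by apply/ndE.
  have [mu0 lam0] := ndE.1 ndB.
  rewrite (casimir_trace_form k2 Sbasis jn BE ndB) m1 mul1r muD.
  rewrite -[m.+1]addn1 natrD m1 addrr_pchar2 // mulr0 addr0.
  suff -> : mu^-1 + (lam + mu) / (mu * lam) = lam^-1 by [].
  have -> : mu^-1 = lam / (mu * lam) by field; rewrite mu0 lam0.
  by rewrite -mulrDl addrA addrr_pchar2 // add0r; field; rewrite mu0 lam0.
- apply: (classified_trace_form k2 Sbasis jn) => lam mu B.
  exact: (form_evenP k2 Sbasis (last_ord n_gt0) parity).
move=> lam mu B invB /(form_evenP k2 Sbasis (last_ord n_gt0) parity _ _ invB) BE.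
have m0 : m%:R = 0 :> k by rewrite natr_parity // (negPf parity).
have ndE := trace_form_nondegenerateP k2 Sbasis jn BE.
rewrite m0 mul0r addr0 in ndE.
split=> [a b|mu0|ndB]; first by rewrite !BE trace_form_sym.
  by apply/ndE.
have [mu0 _] := ndE.1 ndB.
rewrite (casimir_trace_form k2 Sbasis jn BE ndB) m0 mul0r addr0.
rewrite -[m.+1]addn1 natrD m0 add0r mulr1.
have -> : mu^-1 = mu / mu ^+ 2 by field.
by rewrite -expr2 -mulrDl muD -mulrDl.
Qed.
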